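(* The weighted structure constants $wc_{ij}^k$ have the following properties. (1) $wc_{ij}^k$ has degree $\ell(\lambda^i)+\ell(\lambda^j)-\ell(\lambda^k)$. (2) $wc_{ij}^k=0$ unless $\ell(\lambda^k)\le\ell(\lambda^i)+\ell(\lambda^j)$ and $\lambda^k\succeq\lambda^i,\lambda^j$. (3) When $i=k$, $wc_{ij}^i=w\widetilde{S}_{\lambda^j}|_{\lambda^i}$.
   Context: Fix integers $1\le d<n$, a vector $W=(w_1,\dots,w_n)\in(\mathbb{Z}_{\ge 0})^n$ and an integer $a\ge 1$. Let $M_d(n,d)$ be the set of complex $n\times d$ matrices of rank $d$. For $A,B\in M_d(n,d)$ write $A\sim_w B$ if $B=\mathrm{diag}(t^{w_1},\dots,t^{w_n})\,A\,T$ for some $T\in \mathrm{GL}(d,\mathbb{C})$ and $t\in\mathbb{C}^*$ with $t^a=\det(T)$. Put $\mathrm{WGr}(d,n):=M_d(n,d)/\!\sim_w$ with the quotient topology; $T^n=(S^1)^n$ acts by $(t_1,\dots,t_n)\cdot[A]=[\mathrm{diag}(t_1,\dots,t_n)A]$. A Schubert symbol for $d<n$ is a sequence of integers $\lambda=(\lambda_1,\dots,\lambda_d)$ with $1\le\lambda_1<\cdots<\lambda_d\le n$; its length is $\ell(\lambda)=\sum_{j=1}^d(\lambda_j-j)$. Partial order: $\lambda\preceq\mu$ if $\lambda_j\le\mu_j$ for all $j$. Put $m:=\binom{n}{d}-1$ and fix a total order $\lambda^0<\cdots<\lambda^m$ on the Schubert symbols which preserves $\preceq$. Put $c_i:=a+\sum_{j=1}^d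 w_{\lambda^i_j}$. Standing assumption: $\mathrm{WGr}(d,n)$ is divisive with respect to the identity permutation, i.e. $c_i$ divides $c_{i-1}$ for $i=1,\dots,m$. $H^*_{T^n}$ is Borel equivariant cohomology, $H^*_{T^n}(pt;\mathbb{Z})=\mathbb{Z}[y_1,\dots,y_n]$, and $Y_\lambda:=y_{\lambda_1}+\cdots+y_{\lambda_d}$. For $x\in H^*_{T^n}(\mathrm{WGr}(d,n);\mathbb{Z})$, $x|_{\lambda^i}\in\mathbb{Z}[y_1,\dots,y_n]$ is the restriction of $x$ to the fixed point $[C(\lambda^i)]$, where $C(\lambda)$ has columns $e_{\lambda_1},\dots,e_{\lambda_d}$. Let $R(\lambda^i)$ be the set of Schubert symbols obtained from $\lambda^i$ by replacing some $k\in\lambda^i$ by some $k'\notin\lambda^i$ with $k'<k$ and reordering. $w\widetilde{S}_{\lambda^i}$ denotes the (unique) equivariant Schubert class corresponding to $\lambda^i$: the class $x\in H^*_{T^n}(\mathrm{WGr}(d,n);\mathbb{Z})$ such that (1) $x|_{\lambda^k}\ne0$ implies $\lambda^i\preceq\lambda^k$; (2) $x|_{\lambda^i}=\prod_{\lambda^j\in R(\lambda^i)}\big(Y_{\lambda^j}-\frac{c_j}{c_i}Y_{\lambda^i}\big)$; (3) each $x|_{\lambda^k}$ is a homogeneous polynomial in $y_1,\dots,y_n$ of degree $\ell(\lambda^i)$. These classes form a basis of $H^*_{T^n}(\mathrm{WGr}(d,n);\mathbb{Z})$ over $H^*_{T^n}(pt;\mathbb{Z})$, and the weighted structure constants $wc_{ij}^k\in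 H^*_{T^n}(pt;\mathbb{Z})$ are defined by $w\widetilde{S}_{\lambda^i}\,w\widetilde{S}_{\lambda^j}=\sum_{k=0}^m wc_{ij}^k\,w\widetilde{S}_{\lambda^k}$. Degree means degree as a homogeneous polynomial in $y_1,\dots,y_n$ (the zero polynomial being regarded as homogeneous of every degree). *)

(* Defs.v *)
From HB Require Import structures.
From mathcomp Require Import all_boot all_order generic_quotient all_algebra.
From mathcomp Require Import all_classical reals topology normedtype.
From mathcomp Require Import complex.
From mathcomp Require Import -(notations) mpoly.

Set Implicit Arguments.
Unset Strict Implicit.
Unset Printing Implicit Defensive.

Import Order.TTheory GRing.Theory Num.Theory numFieldNormedType.Exports.

Local Open Scope classical_set_scope.
Local Open Scope ring_scope.

Section Continuity.

Lemma continuous_pair (T U V : topologicalType) (f : T -> U) (g : T -> V) :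
  continuous f -> continuous g -> continuous (fun x => (f x, g x)).
Proof. by move=> fc gc x; exact: (cvg_pair (fc x) (gc x)). Qed.

Lemma continuous_compT (T U V : topologicalType) (f : T -> U) (g : U -> V) :
  continuous f -> continuous g -> continuous (fun x => g (f x)).
Proof. by move=> fc gc x; exact: (continuous_comp (fc x) (gc (f x))). Qed.

Lemma continuous_prod_topology (T : topologicalType) (I : Type)
    (K : I -> topologicalType) (f : T -> prod_topology K) :
  (forall i, continuous (fun x => f x i)) -> continuous f.
Proof.
move=> fc x; apply/cvg_sup => i.
pose W : topologicalType := initial_topology (fun g : forall i, K i => g i).
suff fW : continuous (f : T -> W) by exact: fW.
apply/continuousP => B [C Cop <-].
by move/continuousP: (fc i) => /(_ C Cop).
Qed.

Lemma continuous_mx_coord (T : topologicalType) (m n : nat) (K : topologicalType)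
    (f : T -> 'M[K]_(m, n)) :
  (forall i j, continuous (fun x => f x i j)) -> continuous f.
Proof.
move=> fc x A [P Pn PA].
have : \forall y \near x, forall i j, P i j (f y i j).
  apply: filter_forall => i; apply: filter_forall => j.
  exact: (fc i j x _ (Pn i j)).
by apply: filterS => y Py; apply: PA.
Qed.

Lemma continuous_mx_entry (m n : nat) (K : topologicalType) (i : 'I_m) (j : 'I_n) :
  continuous (fun A : 'M[K]_(m, n) => A i j).
Proof.
move=> M A An.
exists (fun i' j' => if (i' == i) && (j' == j) then A else setT).
  move=> i' j'; case: ifP => [/andP[/eqP-> /eqP->]//|_].
  exact: filterT.
by move=> N /(_ i j); rewrite !eqxx.
Qed.

Lemma continuous_set_type (T U : topologicalType) (A : set U)
    (f : T -> set_type A) :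
  continuous (fun x => set_val (f x)) -> continuous f.
Proof.
move=> fc; apply/continuousP => B [C Cop <-].
move/continuousP: fc => /(_ C Cop).
by [].
Qed.

Lemma continuous_set_val (U : topologicalType) (A : set U) :
  continuous (set_val : set_type A -> U).
Proof. exact: initial_continuous. Qed.

End Continuity.

Section SimplexMaps.
Variable R : realType.

Definition std_simplex (p : nat) : set 'rV[R]_p.+1 :=
  [set t | (forall i, 0 <= t 0 i) /\ \sum_i t 0 i = 1].
Arguments std_simplex p : clear implicits.

Definition vertex_map_fun (q p : nat) (g : 'I_q.+1 -> 'I_p.+1)
    (t : 'rV[R]_q.+1) : 'rV[R]_p.+1 :=
  \row_j \sum_(i | g i == j) t 0 i.

Lemma vertex_map_subproof (q p : nat) (g : 'I_q.+1 -> 'I_p.+1)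
    (t : std_simplex q) :
  vertex_map_fun g (set_val t) \in std_simplex p.
Proof.
case: t => t /= tP; move: (set_mem tP) => [t0 t1].
rewrite set_valE /=; apply/mem_set; split=> [j|].
  by rewrite mxE sumr_ge0.
rewrite -[RHS]t1 [RHS](partition_big g xpredT) //=.
by apply: eq_bigr => j _; rewrite mxE.
Qed.

(* The affine map of standard simplices that sends the i-th vertex to the
   (g i)-th vertex. *)
Definition vertex_map (q p : nat) (g : 'I_q.+1 -> 'I_p.+1)
    (t : std_simplex q) : std_simplex p :=
  exist _ (vertex_map_fun g (set_val t)) (vertex_map_subproof g t).

Lemma vertex_map_continuous (q p : nat) (g : 'I_q.+1 -> 'I_p.+1) :
  continuous (vertex_map g).
Proof.
apply: continuous_set_type => t.
apply: (@continuous_comp _ _ _ set_val (vertex_map_fun g)).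
  exact: continuous_set_val.
move: (set_val t); apply: continuous_mx_coord => i j.
under [X in continuous X]funext do rewrite mxE.
apply: continuous_big => [|k _]; first exact: add_continuous.
exact: continuous_mx_entry.
Qed.

HB.instance Definition _ (q p : nat) (g : 'I_q.+1 -> 'I_p.+1) :=
  @isContinuous.Build _ _ (vertex_map g) (@vertex_map_continuous q p g).

Lemma vertex_map_comp (r q p : nat) (g : 'I_q.+1 -> 'I_p.+1)
    (h : 'I_r.+1 -> 'I_q.+1) (t : std_simplex r) :
  vertex_map g (vertex_map h t) = vertex_map (g \o h) t.
Proof.
apply/val_inj/rowP => j; rewrite /= !mxE.
rewrite [RHS](partition_big h (fun i => g i == j)) //=.
apply: eq_bigr => i /eqP gi; rewrite !mxE; apply: eq_bigl => k.
by case: eqP => [->|]; rewrite ?gi ?eqxx ?andbF.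
Qed.

Lemma vertex_map_id (p : nat) (t : std_simplex p) : vertex_map id t = t.
Proof.
apply/val_inj/rowP => j; rewrite /= !mxE.
by rewrite big_pred1_eq.
Qed.

End SimplexMaps.
Arguments std_simplex R p : clear implicits.

Section SingularSimplices.
Variables (R : realType) (X : topologicalType).

Definition singular_simplex (p : nat) := continuousType (std_simplex R p) X.

Definition sing := {p : nat & singular_simplex p}.

Definition sing_dim (s : sing) : nat := tag s.

(* The face of s with vertices g 0, ..., g q; only used when g maps [0, q]
   into [0, sing_dim s]. *)
Definition reface (q : nat) (g : nat -> nat) (s : sing) : sing :=
  existT singular_simplex q
    (tagged s \o vertex_map (fun i : 'I_q.+1 => inord (g i) : 'I_(tag s).+1)).

Lemma sing_eq (p : nat) (f g : singular_simplex p) :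
  f =1 g -> existT singular_simplex p f = existT singular_simplex p g.
Proof. by move=> /continuousEP ->. Qed.

Lemma eq_reface q g h s : (forall i, (i <= q)%N -> g i = h i) ->
  reface q g s = reface q h s.
Proof.
move=> gh; apply: sing_eq => t /=; congr (tagged s (vertex_map _ t)).
by apply/funext => i; rewrite gh // -ltnS.
Qed.

Lemma reface_comp q r g h s : (forall i, (i <= r)%N -> (h i <= q)%N) ->
  reface r h (reface q g s) = reface r (g \o h) s.
Proof.
move=> hq; apply: sing_eq => t /=; rewrite vertex_map_comp.
congr (tagged s (vertex_map _ t)); apply/funext => i /=.
by rewrite inordK // ltnS hq // -ltnS.
Qed.

Lemma reface_id s : reface (sing_dim s) id s = s.
Proof.
case: s => p f; apply: sing_eq => t /=; congr (f _).
rewrite -[RHS](vertex_map_id t); congr (vertex_map _ t).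
by apply/funext => i; rewrite inord_val.
Qed.

End SingularSimplices.

Section Cochains.
Variables (R : realType) (X : topologicalType).
Local Notation sing := (sing R X).

(* All sequences (c_p) of integral singular p-cochains; those with finitely
   many nonzero terms form the direct sum of the C^p(X; Z). *)
Definition cochain := sing -> int.
HB.instance Definition _ := GRing.Zmodule.on cochain.

Definition cup (a b : cochain) : cochain := fun s =>
  \sum_(p < (sing_dim s).+1)
     a (reface p id s) * b (reface (sing_dim s - p) (addn p) s).

Definition cochain1 : cochain := fun s => (sing_dim s == 0)%:R.

Definition coboundary (c : cochain) : cochain := fun s =>
  if sing_dim s is p.+1 then
    \sum_(i < p.+2) (-1) ^+ i * c (reface p (bump i) s)
  else 0.

(* multiplication by (-1)^p on C^p *)
Definition deg_sign (c : cochain) : cochain := fun s => (-1) ^+ sing_dim s * c s.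

Definition finite_degree (c : cochain) : Prop :=
  exists N, forall s, (N <= sing_dim s)%N -> c s = 0.

Lemma cochain_subE (a b : cochain) s : (a - b) s = a s - b s.
Proof. by []. Qed.

Let sum_shift (V : nmodType) n p (G : nat -> V) : (p <= n)%N ->
  \sum_(r < (n - p).+1) G (p + r)%N = \sum_(q < n.+1 | (p <= q)%N) G q.
Proof.
move=> pn; rewrite -(big_geq_mkord _ _ xpredT) -[X in index_iota X]add0n big_addn.
by rewrite big_mkord subSn //; apply: eq_bigr => i _; rewrite addnC.
Qed.

Let leq_addB r m i : (r <= m)%N -> (i <= m - r)%N -> (r + i <= m)%N.
Proof. by move=> rm im; rewrite -(subnKC rm) leq_add2l. Qed.

Let leq_bumpS i j q : (j <= q)%N -> (bump i j <= q.+1)%N.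
Proof. by move=> jq; rewrite /bump -addn1 addnC leq_add // leq_b1. Qed.

Lemma cupA : associative cup.
Proof.
move=> a b c; apply/funext => s; rewrite /cup.
set n := sing_dim s.
transitivity (\sum_(p < n.+1) \sum_(q < n.+1 | (p <= q)%N)
   a (reface p id s) * b (reface (q - p) (addn p) s) *
   c (reface (n - q) (addn q) s)).
  apply: eq_bigr => p _; rewrite mulr_sumr /=.
  have pn : (p <= n)%N by rewrite -ltnS.
  rewrite -(sum_shift (fun q => a (reface p id s) *
     b (reface (q - p) (addn p) s) * c (reface (n - q) (addn q) s))) //.
  apply: eq_bigr => r _; have rn : (r <= n - p)%N by rewrite -ltnS.
  rewrite addKn mulrA subnDA !reface_comp.
  - by congr (_ * _); congr (c _); apply: eq_reface => i _; rewrite /= addnA.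
  - by move=> i; apply: leq_addB.
  - by move=> i ir; apply: leq_trans rn.
rewrite (exchange_big_dep xpredT) //=; apply: eq_bigr => q _.
have qn : (q <= n)%N by rewrite -ltnS.
rewrite mulr_suml (big_ord_widen_cond n.+1 xpredT (fun p => a (reface p id (reface q id s)) * b (reface (q - p) (addn p) (reface q id s)) * c (reface (n - q) (addn q) s))) //.
apply: eq_big => [p|p pq]; first by rewrite /= ?ltnS.
rewrite !reface_comp // => i ir; last exact: leq_trans pq.
exact: leq_addB.
Qed.

Lemma cup1l : left_id cochain1 cup.
Proof.
move=> a; apply/funext => s; rewrite /cup big_ord_recl /= big1 => [|i _].
  rewrite /cochain1 /= mul1r addr0 subn0.
  by rewrite -[in RHS](reface_id s); congr a; exact: eq_reface.
by rewrite /cochain1 /= mul0r.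
Qed.

Lemma cup1r : right_id cochain1 cup.
Proof.
move=> a; apply/funext => s; rewrite /cup big_ord_recr /= big1 => [|i _].
  by rewrite /cochain1 /= subnn mulr1 add0r reface_id.
by rewrite /cochain1 /= subn_eq0 leqNgt ltn_ord mulr0.
Qed.

Lemma cupDl : left_distributive cup +%R.
Proof.
move=> a b c; apply/funext => s; rewrite /cup -[RHS]/(_ s + _ s) /= -big_split.
by apply: eq_bigr => i _; exact: mulrDl.
Qed.

Lemma cupDr : right_distributive cup +%R.
Proof.
move=> a b c; apply/funext => s; rewrite /cup -[RHS]/(_ s + _ s) /= -big_split.
by apply: eq_bigr => i _; exact: mulrDr.
Qed.

HB.instance Definition _ :=
  GRing.Zmodule_isPzRing.Build cochain cupA cup1l cup1r cupDl cupDr.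

Lemma coboundaryB a b : coboundary (a - b) = coboundary a - coboundary b.
Proof.
apply/funext => s; rewrite cochain_subE /coboundary; case: (sing_dim s) => [|p].
  by rewrite subr0.
by rewrite -sumrB; apply: eq_bigr => i _; rewrite cochain_subE mulrBr.
Qed.

Lemma coboundary0 : coboundary 0 = 0.
Proof. by rewrite -(subr0 0) coboundaryB subrr. Qed.

Lemma coboundary1 : coboundary 1 = 0.
Proof.
apply/funext => s; rewrite /coboundary; case: (sing_dim s) => [//|[|p]].
  by rewrite big_ord_recl big_ord1 /= mul1r expr1 mulN1r addrN.
by rewrite big1 // => i _; rewrite mulr0.
Qed.

Lemma deg_signK : involutive deg_sign.
Proof.
by move=> a; apply/funext=> s; rewrite /deg_sign mulrA -expr2 sqrr_sign mul1r.
Qed.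

Lemma coboundary_sign a : coboundary (deg_sign a) = - deg_sign (coboundary a).
Proof.
apply/funext => s; rewrite -[RHS]/(- (_ s)) /deg_sign /coboundary.
case: (sing_dim s) => [|p]; first by rewrite mulr0 oppr0.
rewrite mulr_sumr -sumrN; apply: eq_bigr => i _.
by rewrite mulrCA exprS mulN1r mulNr opprK.
Qed.

Lemma coboundaryM (a b : cochain) :
  coboundary (a * b) = coboundary a * b + deg_sign a * coboundary b.
Proof.
apply/funext => s; rewrite -[RHS]/(cup (coboundary a) b s + cup (deg_sign a) (coboundary b) s).
rewrite -[a * b]/(cup a b).
rewrite [in LHS]/coboundary.
case E: (sing_dim s) => [|n].
  by rewrite /cup E !big_ord1 /coboundary /= mul0r mulr0 addr0.
rewrite [in RHS]/cup E.
pose A p := \sum_(0 <= i < p.+1) (-1) ^+ i * a (reface p (bump i) s) *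
   b (reface (n - p) (addn p.+1) s).
pose M p := (-1) ^+ p * a (reface p id s) * b (reface (n - p) (addn p.+1) s).
pose B p := \sum_(0 <= k < (n - p).+1) (-1) ^+ (p + k.+1) * a (reface p id s) *
   b (reface (n - p) (fun j => p + bump k.+1 j)%N s).
transitivity (\sum_(p < n.+1) (A p + B p)).
  under eq_bigr do rewrite /cup /= mulr_sumr.
  rewrite exchange_big /=; apply: eq_bigr => p _.
  have pn : (p <= n)%N by rewrite -ltnS.
  pose F i := (-1) ^+ i * (a (reface p id (reface n (bump i) s)) *
              b (reface (n - p) (addn p) (reface n (bump i) s))).
  rewrite -(big_mkord xpredT F) (big_cat_nat (n := p.+1)) //=; last by rewrite ltnS leqW.
  congr (_ + _).
    apply: eq_big_nat => i /andP[_ ip]; rewrite /F !reface_comp.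
    - rewrite mulrA; congr (_ * _); congr b; apply: eq_reface => j _ /=.
      by rewrite /bump (leq_trans _ (leq_addr _ _)) // -ltnS.
    - by move=> j; apply: leq_addB.
    - by move=> j jp; apply: leq_trans pn.
  rewrite -[X in index_iota X]add0n big_addn subSS subSn //.
  apply: eq_big_nat => k _; rewrite /F !reface_comp.
  - rewrite mulrA [(k + p.+1)%N]addnC addSnnS; congr (_ * a _ * b _).
    + apply: eq_reface => j jp /=.
      by rewrite /bump leqNgt (leq_ltn_trans jp) // addnS ltnS leq_addr.
    + by apply: eq_reface => j _ /=; rewrite /bump leq_add2l addnCA.
  - by move=> j; apply: leq_addB.
  - by move=> j jp; apply: leq_trans pn.
transitivity (\sum_(p < n.+1) (A p - M p) + \sum_(p < n.+1) (M p + B p)).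
  rewrite -big_split /=; apply: eq_bigr => p _.
  by rewrite addrA subrK.
congr (_ + _).
  rewrite [RHS]big_ord_recl {1}/coboundary /= mul0r add0r.
  apply: eq_bigr => p _; rewrite /coboundary /=.
  have pn : (p <= n)%N by rewrite -ltnS.
  rewrite subSS big_ord_recr /= mulrDl; congr (_ + _).
    rewrite /A big_mkord mulr_suml; apply: eq_bigr => i _; rewrite reface_comp //.
    by move=> j; apply: leq_bumpS.
  rewrite /M reface_comp => [|j jp]; last first.
    exact: leq_bumpS.
  rewrite exprS mulN1r !mulNr; congr (- (_ * a _ * _)).
  by apply: eq_reface => j jp /=; rewrite /bump leqNgt ltnS jp.
rewrite [RHS]big_ord_recr /= subnn {2}/coboundary /= mulr0 addr0.
apply: eq_bigr => p _; rewrite /deg_sign /=.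
have pn : (p <= n)%N by rewrite -ltnS.
rewrite subSn // /coboundary /= big_ord_recl /= mul1r mulrDr; congr (_ + _).
  rewrite /M reface_comp => [|j jn]; last by rewrite /bump.
  by congr (_ * b _); apply: eq_reface => j _ /=; rewrite /bump /= addnA addn1.
rewrite /B big_mkord mulr_sumr; apply: eq_bigr => k _; rewrite reface_comp.
  by rewrite mulrCA !mulrA exprD [(-1) ^+ p * _]mulrC.
by move=> j; apply: leq_bumpS.
Qed.

End Cochains.

Section Cohomology.
Variables (R : realType) (X : topologicalType).
Local Notation cochain := (cochain R X).
Implicit Types a b c : cochain.

Lemma finite_degreeB a b :
  finite_degree a -> finite_degree b -> finite_degree (a - b).
Proof.
move=> [M aM] [N bN]; exists (maxn M N) => s; rewrite geq_max => /andP[sM sN].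
by rewrite cochain_subE aM ?bN ?subr0.
Qed.

Lemma finite_degreeM a b :
  finite_degree a -> finite_degree b -> finite_degree (a * b).
Proof.
move=> [M aM] [N bN]; exists (M + N)%N => s sMN.
rewrite -[(a * b) s]/(cup a b s) /cup big1 // => p _.
have [Mp|pM] := leqP M p; first by rewrite aM ?mul0r.
have -> : b (reface (sing_dim s - p) (addn p) s) = 0; last by rewrite mulr0.
apply: bN; rewrite -[sing_dim (reface _ _ _)]/(sing_dim s - p)%N.
have ps : (p <= sing_dim s)%N by rewrite -ltnS.
by rewrite leq_subRL // (leq_trans _ sMN) // leq_add2r ltnW.
Qed.

Lemma finite_degree1 : finite_degree (1 : cochain).
Proof. exists 1%N => s s0; change (cochain1 s = 0).
by rewrite /cochain1 gtn_eqF. Qed.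

Lemma finite_degree0 : finite_degree (0 : cochain).
Proof. by exists 0%N. Qed.

Lemma finite_degree_sign a : finite_degree a -> finite_degree (deg_sign a).
Proof. by move=> [N aN]; exists N => s sN; rewrite /deg_sign aN ?mulr0. Qed.

Definition is_cocycle : {pred cochain} :=
  fun c => `[< finite_degree c /\ coboundary c = 0 >].

Lemma is_cocycle_subring : subring_closed is_cocycle.
Proof.
split=> [|a b|a b].
- by apply/asboolP; split; [exact: finite_degree1|exact: coboundary1].
- move=> /asboolP[fa da] /asboolP[fb db]; apply/asboolP; split.
    exact: finite_degreeB.
  by rewrite coboundaryB da db subrr.
- move=> /asboolP[fa da] /asboolP[fb db]; apply/asboolP; split.
    exact: finite_degreeM.
  by rewrite coboundaryM da db mul0r mulr0 addr0.
Qed.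

Record cocycle := Cocycle { cocycle_val :> cochain; _ : is_cocycle cocycle_val }.
HB.instance Definition _ := [isSub for cocycle_val].
HB.instance Definition _ := [Choice of cocycle by <:].
HB.instance Definition _ :=
  GRing.SubChoice_isSubPzRing.Build cochain is_cocycle cocycle is_cocycle_subring.

Lemma cocycleP (z : cocycle) : finite_degree z /\ coboundary z = 0.
Proof. exact/asboolP/(valP z). Qed.

Definition is_coboundary : {pred cocycle} :=
  fun z => `[< exists2 c : cochain, finite_degree c & cocycle_val z = coboundary c >].

Lemma is_coboundary_zmod : zmod_closed is_coboundary.
Proof.
split=> [|x y].
  by apply/asboolP; exists 0; [exact: finite_degree0|rewrite coboundary0].
move=> /asboolP[a fa xa] /asboolP[b fb yb]; apply/asboolP.
by exists (a - b); [exact: finite_degreeB|rewrite coboundaryB -xa -yb].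
Qed.
HB.instance Definition _ := GRing.isZmodClosed.Build cocycle is_coboundary is_coboundary_zmod.

Lemma is_coboundaryMl (x y : cocycle) :
  y \in is_coboundary -> x * y \in is_coboundary.
Proof.
move=> /asboolP[b fb yb]; apply/asboolP; have [fx dx] := cocycleP x.
exists (deg_sign x * b).
  by apply: finite_degreeM => //; exact: finite_degree_sign.
rewrite coboundaryM coboundary_sign dx deg_signK -yb.
rewrite [deg_sign 0](_ : _ = 0) ?oppr0 ?mul0r ?add0r //.
by apply/funext => s; rewrite /deg_sign mulr0.
Qed.

Lemma is_coboundaryMr (x y : cocycle) :
  x \in is_coboundary -> x * y \in is_coboundary.
Proof.
move=> /asboolP[a fa xa]; apply/asboolP; have [fy dy] := cocycleP y.
exists (a * (y : cochain)); first exact: finite_degreeM.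
by rewrite coboundaryM dy mulr0 addr0 -xa.
Qed.

(* The total singular cohomology: the direct sum of the H^p(X; Z). *)
Definition cohomology := Quotient.quot is_coboundary.
HB.instance Definition _ := GRing.Zmodule.on cohomology.

Definition coh_class (z : cocycle) : cohomology := \pi_cohomology%qT z.

Lemma coh_class_eqP (x y : cocycle) :
  coh_class x = coh_class y <-> x - y \in is_coboundary.
Proof.
by split=> [/eqP|xy]; [|apply/eqP]; rewrite /coh_class -Quotient.idealrBE.
Qed.

Lemma coh_class_repr (u : cohomology) : coh_class (repr u) = u.
Proof. exact: reprK. Qed.

Lemma coh_classB (x y : cocycle) : coh_class (x - y) = coh_class x - coh_class y.
Proof. exact: raddfB. Qed.

Lemma coh_classD (x y : cocycle) : coh_class (x + y) = coh_class x + coh_class y.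
Proof. exact: raddfD. Qed.

Definition coh_mul (u v : cohomology) : cohomology :=
  coh_class (repr u * repr v).

Lemma coh_mulE (x y : cocycle) : coh_mul (coh_class x) (coh_class y) = coh_class (x * y).
Proof.
apply/coh_class_eqP; set x' := repr _; set y' := repr _.
rewrite -[x' * y'](addrNK (x * y')) -addrA -mulrBl -mulrBr rpredD //.
  by apply: is_coboundaryMr; apply/coh_class_eqP; exact: coh_class_repr.
by apply: is_coboundaryMl; apply/coh_class_eqP; exact: coh_class_repr.
Qed.

Lemma coh_mulA : associative coh_mul.
Proof.
move=> u v w; rewrite -[u]coh_class_repr -[v]coh_class_repr -[w]coh_class_repr.
by rewrite !coh_mulE mulrA.
Qed.

Lemma coh_mul1l : left_id (coh_class 1) coh_mul.
Proof. by move=> u; rewrite -[u]coh_class_repr coh_mulE mul1r. Qed.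

Lemma coh_mul1r : right_id (coh_class 1) coh_mul.
Proof. by move=> u; rewrite -[u]coh_class_repr coh_mulE mulr1. Qed.

Lemma coh_mulDl : left_distributive coh_mul +%R.
Proof.
move=> u v w; rewrite -[u]coh_class_repr -[v]coh_class_repr -[w]coh_class_repr.
by rewrite -coh_classD !coh_mulE -coh_classD mulrDl.
Qed.

Lemma coh_mulDr : right_distributive coh_mul +%R.
Proof.
move=> u v w; rewrite -[u]coh_class_repr -[v]coh_class_repr -[w]coh_class_repr.
by rewrite -coh_classD !coh_mulE -coh_classD mulrDr.
Qed.

HB.instance Definition _ := GRing.Zmodule_isPzRing.Build cohomology
  coh_mulA coh_mul1l coh_mul1r coh_mulDl coh_mulDr.

Lemma coh_class_is_zmod : zmod_morphism coh_class.
Proof. exact: coh_classB. Qed.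

Lemma coh_class_is_monoid : monoid_morphism coh_class.
Proof. by split=> // x y; rewrite -coh_mulE. Qed.

HB.instance Definition _ :=
  GRing.isZmodMorphism.Build cocycle cohomology coh_class coh_class_is_zmod.
HB.instance Definition _ :=
  GRing.isMonoidMorphism.Build cocycle cohomology coh_class coh_class_is_monoid.

(* u lies in the summand H^p(X; Z) *)
Definition in_degree (p : nat) (u : cohomology) : Prop :=
  exists2 z : cocycle, u = coh_class z &
    forall s, sing_dim s != p -> (z : cochain) s = 0.

End Cohomology.

Section Pullback.
Variables (R : realType) (X Y : topologicalType) (f : continuousType X Y).

Definition sing_map (s : sing R X) : sing R Y :=
  existT (singular_simplex R Y) (tag s) (f \o tagged s).

Definition cochain_map (c : cochain R Y) : cochain R X := c \o sing_map.

Lemma sing_map_reface q g s : sing_map (reface q g s) = reface q g (sing_map s).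
Proof. exact: sing_eq. Qed.

Lemma cochain_mapB c c' : cochain_map (c - c') = cochain_map c - cochain_map c'.
Proof. by []. Qed.

Lemma cochain_mapM c c' : cochain_map (c * c') = cochain_map c * cochain_map c'.
Proof.
apply/funext => s; change (cup c c' (sing_map s) = cup (cochain_map c) (cochain_map c') s).
apply: eq_bigr => p _; rewrite /cochain_map /=.
by rewrite !sing_map_reface.
Qed.

Lemma coboundary_map c : coboundary (cochain_map c) = cochain_map (coboundary c).
Proof.
apply/funext => s; rewrite /cochain_map /= /coboundary.
rewrite -[sing_dim (sing_map s)]/(sing_dim s); case: (sing_dim s) => // p.
by apply: eq_bigr => i _; rewrite /= sing_map_reface.
Qed.

Lemma finite_degree_map c : finite_degree c -> finite_degree (cochain_map c).
Proof. by move=> [N cN]; exists N => s sN; exact: cN. Qed.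

Lemma cocycle_map_subproof (z : cocycle R Y) : is_cocycle (cochain_map z).
Proof.
apply/asboolP; have [fz dz] := cocycleP z.
by split; [exact: finite_degree_map|rewrite coboundary_map dz].
Qed.

Definition cocycle_map (z : cocycle R Y) : cocycle R X :=
  Cocycle (cocycle_map_subproof z).

Lemma cocycle_map_is_zmod : zmod_morphism cocycle_map.
Proof. by move=> x y; apply: val_inj. Qed.

Lemma cocycle_map_is_monoid : monoid_morphism cocycle_map.
Proof. by split=> [|x y]; apply: val_inj => //=; rewrite cochain_mapM. Qed.

HB.instance Definition _ := GRing.isZmodMorphism.Build
  (cocycle R Y) (cocycle R X) cocycle_map cocycle_map_is_zmod.
HB.instance Definition _ := GRing.isMonoidMorphism.Build
  (cocycle R Y) (cocycle R X) cocycle_map cocycle_map_is_monoid.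

Definition coh_map (u : cohomology R Y) : cohomology R X :=
  coh_class (cocycle_map (repr u)).

Lemma coh_mapE (z : cocycle R Y) : coh_map (coh_class z) = coh_class (cocycle_map z).
Proof.
apply/coh_class_eqP; rewrite -raddfB.
have /coh_class_eqP/asboolP[c fc zc] := coh_class_repr (coh_class z).
apply/asboolP; exists (cochain_map c); first exact: finite_degree_map.
by rewrite coboundary_map -zc.
Qed.

Lemma coh_map_is_zmod : zmod_morphism coh_map.
Proof.
move=> u v; rewrite -[u]coh_class_repr -[v]coh_class_repr.
by rewrite -coh_classB !coh_mapE -coh_classB cocycle_map_is_zmod.
Qed.

Lemma coh_map_is_monoid : monoid_morphism coh_map.
Proof.
split=> [|u v]; first by rewrite -(rmorph1 (@coh_class R Y)) coh_mapE rmorph1.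
rewrite -[u]coh_class_repr -[v]coh_class_repr.
by rewrite -rmorphM !coh_mapE -rmorphM cocycle_map_is_monoid.2.
Qed.

HB.instance Definition _ := GRing.isZmodMorphism.Build
  (cohomology R Y) (cohomology R X) coh_map coh_map_is_zmod.
HB.instance Definition _ := GRing.isMonoidMorphism.Build
  (cohomology R Y) (cohomology R X) coh_map coh_map_is_monoid.

End Pullback.

(* The field of complex numbers, with the topology of its modulus. *)
Definition Cplx (R : realType) : numClosedFieldType := R[i].

Section Torus.
Variables (R : realType) (n : nat).
Local Notation C := (Cplx R).

Definition torus_set : set {ptws 'I_n -> C} := [set t | forall i, `|t i| = 1].
Definition torus := set_type torus_set.
HB.instance Definition _ := Topological.on torus.

Definition tcoord (t : torus) (i : 'I_n) : C := (set_val t : 'I_n -> C) i.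

Lemma tcoord_norm t i : `|tcoord t i| = 1.
Proof. exact: (set_valP t). Qed.

Lemma tcoord_neq0 t i : tcoord t i != 0.
Proof. by rewrite -normr_eq0 tcoord_norm oner_neq0. Qed.

Definition mk_torus (f : 'I_n -> C) (f1 : forall i, `|f i| = 1) : torus :=
  exist _ (f : {ptws 'I_n -> C}) (mem_set f1).

Lemma torus_eq (s t : torus) : tcoord s =1 tcoord t -> s = t.
Proof. by move=> st; apply: val_inj; apply/funext. Qed.

Definition torus1 : torus :=
  @mk_torus (fun=> 1) (fun=> normr1 _).

Lemma torusM_subproof (s t : torus) i : `|tcoord s i * tcoord t i| = 1.
Proof. by rewrite normrM !tcoord_norm mulr1. Qed.
Definition torusM (s t : torus) : torus := mk_torus (torusM_subproof s t).

Lemma torusV_subproof (t : torus) i : `|(tcoord t i)^-1| = 1.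
Proof. by rewrite normfV tcoord_norm invr1. Qed.
Definition torusV (t : torus) : torus := mk_torus (torusV_subproof t).

Lemma torusVM t : torusM (torusV t) t = torus1.
Proof. by apply: torus_eq => i; exact: mulVf (tcoord_neq0 t i). Qed.

Record tspace := TSpace {
  tspace_sort :> topologicalType;
  tact : torus -> tspace_sort -> tspace_sort;
  tact1 : forall x, tact torus1 x = x;
  tactM : forall s t x, tact (torusM s t) x = tact s (tact t x);
  tact_continuous : continuous (fun p : torus * tspace_sort => tact p.1 p.2)
}.

Record tmap (X Y : tspace) := TMap {
  tmap_fun :> X -> Y;
  tmap_continuous : continuous tmap_fun;
  tmap_act : forall t x, tmap_fun (tact t x) = tact t (tmap_fun x)
}.

Lemma tpoint_continuous :
  continuous (fun p : torus * discrete_topology unit => p.2).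
Proof. by move=> p; exact: cvg_snd. Qed.

Definition tpoint : tspace :=
  @TSpace (discrete_topology unit) (fun _ x => x)
    (fun _ => erefl) (fun _ _ _ => erefl) tpoint_continuous.

Definition to_tpoint (X : tspace) : tmap X tpoint :=
  @TMap X tpoint (fun=> tt) (fun x => cvg_cst _) (fun _ _ => erefl).

Definition fixed_point (X : tspace) (x : X) (xfix : forall t, tact t x = x) :
  tmap tpoint X :=
  @TMap tpoint X (fun=> x) (fun p => cvg_cst _) (fun t _ => esym (xfix t)).

End Torus.

Section UniversalBundle.
Variables (R : realType) (n : nat).
Local Notation C := (Cplx R).

(* The nonzero complex sequences, a model of ES^1: contractible (by means of
   the shift), with a free and locally trivial action of S^1 by scaling. *)
Definition ES1 :=
  set_type ([set x | exists k, (x : nat -> C) k != 0] : set {ptws nat -> C}).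
HB.instance Definition _ := Topological.on ES1.

Definition es_coord (x : ES1) (k : nat) : C := (set_val x : nat -> C) k.

Lemma scale_ES1_subproof (z : C) (z0 : z != 0) (x : ES1) :
  exists k, z * es_coord x k != 0.
Proof. by have [k xk] := set_valP x; exists k; rewrite mulf_neq0. Qed.

Definition scale_ES1 (z : C) (z0 : z != 0) (x : ES1) : ES1 :=
  exist _ ((fun k => z * es_coord x k) : {ptws nat -> C})
    (mem_set (scale_ES1_subproof z0 x)).

(* ET^n = (ES^1)^n *)
Definition ET := {ptws 'I_n -> ES1}.
HB.instance Definition _ := Topological.on ET.

Definition eact (t : torus R n) (e : ET) : ET :=
  fun i => scale_ES1 (tcoord_neq0 t i) (e i).

Lemma ES1_eq (x y : ES1) : es_coord x =1 es_coord y -> x = y.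
Proof. by move=> xy; apply: val_inj; apply/funext. Qed.

Lemma eact1 e : eact (torus1 R n) e = e.
Proof. by apply/funext => i; apply: ES1_eq => k; exact: mul1r. Qed.

Lemma eactM s t e : eact (torusM s t) e = eact s (eact t e).
Proof.
by apply/funext => i; apply: ES1_eq => k; exact: esym (mulrA _ _ _).
Qed.

End UniversalBundle.

Section BorelConstruction.
Variables (R : realType) (n : nat).
Implicit Types X Y : tspace R n.

Definition borel_rel X : rel (ET R n * X) := fun p q =>
  `[< exists t : torus R n, q = (eact t p.1, tact t p.2) >].

Lemma borel_rel_equiv X : equiv_class_of (@borel_rel X).
Proof.
split=> [[e x]|p q|q p r].
- by apply/asboolP; exists (torus1 R n); rewrite /= eact1 tact1.
- have sym (a b : ET R n * X) : borel_rel a b -> borel_rel b a.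
    move=> /asboolP[t ->]; apply/asboolP; exists (torusV t).
    by rewrite /= -eactM -tactM torusVM eact1 tact1; case: a.
  by apply/idP/idP; exact: sym.
- move=> /asboolP[s ->] /asboolP[t ->]; apply/asboolP; exists (torusM t s).
  by rewrite /= eactM tactM.
Qed.

Canonical borel_equiv X := EquivRelPack (borel_rel_equiv X).

(* The homotopy quotient (ET^n x X) / T^n. *)
Definition borel X := quotient_topology {eq_quot (borel_equiv X)}%qT.
HB.instance Definition _ X := Topological.on (borel X).
HB.instance Definition _ X := Quotient.on (borel X).

Definition borel_class X (p : ET R n * X) : borel X := \pi_(borel X)%qT p.

Lemma borel_class_eqP X (p q : ET R n * X) :
  borel_class p = borel_class q <->
  exists t : torus R n, q = (eact t p.1, tact t p.2).
Proof.
pose Q := {eq_quot (borel_equiv X)}%qT.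
change (\pi_Q%qT p = \pi_Q%qT q <-> exists t, q = (eact t p.1, tact t p.2)).
split=> [/eqP|pq]; first by rewrite eqmodE => /asboolP.
by apply/eqP; rewrite eqmodE; apply/asboolP.
Qed.

Lemma borel_class_continuous X : continuous (@borel_class X).
Proof. exact: pi_continuous. Qed.

Section BorelMap.
Variables (X Y : tspace R n) (f : tmap X Y).

Definition borel_map (q : borel X) : borel Y :=
  let p := repr q in borel_class (p.1, f p.2).

Lemma borel_mapE p : borel_map (borel_class p) = borel_class (p.1, f p.2).
Proof.
rewrite /borel_map; apply/borel_class_eqP => /=.
have /borel_class_eqP[t pE] : borel_class (repr (borel_class p)) = borel_class p.
  exact: reprK.
by exists t; rewrite [in LHS]pE /= tmap_act.
Qed.

Lemma borel_map_continuous : continuous borel_map.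
Proof.
apply/quotient_continuous.
rewrite (_ : _ \o _ = fun p => borel_class (p.1, f p.2)); last first.
  by apply/funext => p; exact: borel_mapE.
apply: (continuous_compT (f := fun p : ET R n * X => (p.1, f p.2))).
  apply: continuous_pair; first by move=> p; exact: cvg_fst.
  apply: continuous_compT; last exact: tmap_continuous.
  by move=> p; exact: cvg_snd.
exact: borel_class_continuous.
Qed.

HB.instance Definition _ :=
  isContinuous.Build (borel X) (borel Y) borel_map borel_map_continuous.

End BorelMap.

(* Borel equivariant cohomology with integral coefficients. *)
Definition HT X := cohomology R (borel X).
HB.instance Definition _ X := GRing.PzRing.on (HT X).

Definition HT_map X Y (f : tmap X Y) : HT Y -> HT X :=
  coh_map (borel_map f : continuousType (borel X) (borel Y)).
HB.instance Definition _ X Y (f : tmap X Y) := GRing.RMorphism.on (HT_map f).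

End BorelConstruction.

Section ClassifyingSpace.
Variables (R : realType) (n : nat).

(* BT^n -> BS^1, induced by the i-th projection T^n -> S^1. *)
Definition et_proj (i : 'I_n) (e : ET R n) : ET R 1 := fun=> e i.

Definition bt_proj (i : 'I_n) (q : borel (tpoint R n)) : borel (tpoint R 1) :=
  borel_class (et_proj i (repr q).1, tt : tpoint R 1).

Lemma bt_projE i p : bt_proj i (borel_class p) = borel_class (et_proj i p.1, tt : tpoint R 1).
Proof.
apply/borel_class_eqP => /=.
have /borel_class_eqP[t pE] : borel_class (repr (borel_class p)) = borel_class p.
  exact: reprK.
exists (mk_torus (fun=> tcoord_norm t i)); congr (_, _).
apply/funext => j; apply: ES1_eq => k; rewrite [in LHS]pE; by [].
Qed.

Lemma bt_proj_continuous i : continuous (bt_proj i).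
Proof.
apply/quotient_continuous.
rewrite (_ : _ \o _ = fun p => borel_class (et_proj i p.1, tt : tpoint R 1)); last first.
  by apply/funext => p; exact: bt_projE.
apply: continuous_compT; last exact: borel_class_continuous.
apply: continuous_pair; last by move=> p; exact: cvg_cst.
apply: continuous_prod_topology => j.
apply: (@continuous_compT _ _ _ fst (fun e : ET R n => e i)).
  by move=> p; exact: cvg_fst.
exact: proj_continuous.
Qed.

HB.instance Definition _ i :=
  isContinuous.Build _ _ (bt_proj i) (@bt_proj_continuous i).

(* Z[y_1, ..., y_n] *)
Definition ypoly := mpoly n int.
HB.instance Definition _ := GRing.ComNzRing.on ypoly.
Definition yvar (i : 'I_n) : ypoly := mpolyX int (mnm1 i).

(* The identification H^*_T(pt; Z) = Z[y_1, ..., y_n]: y_i is the pullback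
   under the i-th projection of one generator u of H^2(BS^1; Z).  The choice
   of u, i.e. the sign convention for Chern classes, is left free. *)
Record point_ident := PointIdent {
  pt_class :> {rmorphism ypoly -> HT (tpoint R n)};
  pt_poly : HT (tpoint R n) -> ypoly;
  pt_classK : cancel pt_class pt_poly;
  pt_polyK : cancel pt_poly pt_class;
  pt_class_yvar : exists2 u : HT (tpoint R 1), in_degree 2 u &
    forall i, pt_class (yvar i) =
      coh_map (bt_proj i : continuousType (borel (tpoint R n)) (borel (tpoint R 1))) u
}.

Variable phi : point_ident.

(* The H^*_T(pt)-module structure of H^*_T(X). *)
Definition ht_scale (X : tspace R n) (p : ypoly) (x : HT X) : HT X :=
  HT_map (to_tpoint X) (phi p) * x.

(* x|_p for a fixed point p of X. *)
Definition ht_restrict (X : tspace R n) (p : X) (pfix : forall t, tact t p = p)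
    (x : HT X) : ypoly :=
  pt_poly phi (HT_map (fixed_point pfix) x).

(* Homogeneity in degree e for an integer e: only 0 has negative degree. *)
Definition yhomog (e : int) (p : ypoly) : Prop :=
  if e is Posz k then p \is ishomog1 k mdeg else p = 0.

End ClassifyingSpace.

Lemma continuous_mulT (T : topologicalType) (K : numClosedFieldType) (f g : T -> K) :
  continuous f -> continuous g -> continuous (fun x => f x * g x).
Proof. by move=> fc gc x; apply: cvgM; [exact: fc | exact: gc]. Qed.

Section WeightedGrassmannian.
Variables (R : realType) (n d : nat) (W : 'I_n -> nat) (a : nat).
Local Notation C := (Cplx R).

(* M_d(n, d) *)
Definition frame := set_type ([set A | \rank A = d] : set 'M[C]_(n, d)).
HB.instance Definition _ := Topological.on frame.

Definition frame_mx (A : frame) : 'M[C]_(n, d) := set_val A.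

Lemma frame_rank A : \rank (frame_mx A) = d.
Proof. exact: (set_valP A). Qed.

Definition mk_frame (A : 'M[C]_(n, d)) (Ad : \rank A = d) : frame :=
  exist _ A (mem_set Ad).

Lemma frame_eq A B : frame_mx A = frame_mx B -> A = B.
Proof. exact: val_inj. Qed.

Definition weight_mx (t : C) : 'M[C]_n := diag_mx (\row_i t ^+ W i).

Definition wsim : rel frame := fun A B =>
  `[< exists t : C, exists T : 'M[C]_d,
      [/\ t != 0, T \in unitmx, t ^+ a = \det T &
          frame_mx B = weight_mx t *m frame_mx A *m T] >].

Lemma weight_mxM s t : weight_mx (s * t) = weight_mx s *m weight_mx t.
Proof.
rewrite /weight_mx mulmx_diag; congr diag_mx.
by apply/rowP => i; rewrite !mxE exprMn.
Qed.

Lemma weight_mx1 : weight_mx 1 = 1%:M.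
Proof.
rewrite /weight_mx -diag_const_mx; congr diag_mx.
by apply/rowP => i; rewrite !mxE expr1n.
Qed.

Lemma wsim_equiv : equiv_class_of wsim.
Proof.
have sym A B : wsim A B -> wsim B A.
  move=> /asboolP[t [T [t0 Tu tT BA]]]; apply/asboolP; exists t^-1, (invmx T).
  split; rewrite ?invr_eq0 ?unitmx_inv //; first by rewrite det_inv exprVn tT.
  by rewrite BA !mulmxA -weight_mxM mulVf // weight_mx1 mul1mx mulmxK.
split=> [A|A B|B A D].
- apply/asboolP; exists 1, 1%:M; split; rewrite ?oner_neq0 ?unitmx1 //.
    by rewrite expr1n det1.
  by rewrite weight_mx1 mul1mx mulmx1.
- by apply/idP/idP; exact: sym.
- move=> /asboolP[s [S [s0 Su sS BE]]] /asboolP[t [T [t0 Tu tT DE]]].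
  apply/asboolP; exists (t * s), (S *m T).
  split; rewrite ?mulf_neq0 ?unitmx_mul ?Su //.
    by rewrite exprMn sS tT det_mulmx mulrC.
  by rewrite DE BE !mulmxA -weight_mxM.
Qed.

Canonical wsim_eq := EquivRelPack wsim_equiv.

Definition wgr := quotient_topology {eq_quot wsim_eq}%qT.
HB.instance Definition _ := Topological.on wgr.
HB.instance Definition _ := Quotient.on wgr.

Definition wgr_class (A : frame) : wgr := \pi_wgr%qT A.

Lemma wgr_class_eqP A B :
  wgr_class A = wgr_class B <->
  exists t : C, exists T : 'M[C]_d,
      [/\ t != 0, T \in unitmx, t ^+ a = \det T &
          frame_mx B = weight_mx t *m frame_mx A *m T].
Proof.
pose Q := {eq_quot wsim_eq}%qT.
rewrite -[wgr_class A = _]/(\pi_Q%qT A = \pi_Q%qT B).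
split=> [/eqP|AB]; first by rewrite eqmodE => /asboolP.
by apply/eqP; rewrite eqmodE; apply/asboolP.
Qed.

Lemma wgr_class_repr (q : wgr) : wgr_class (repr q) = q.
Proof. exact: reprK. Qed.

Lemma wgr_class_continuous : continuous wgr_class.
Proof. exact: pi_continuous. Qed.

Lemma frame_move_rank (D : 'M[C]_n) (T : 'M[C]_d) (A : frame) :
  D \in unitmx -> T \in unitmx -> \rank (D *m frame_mx A *m T) = d.
Proof.
move=> Du Tu; rewrite mxrankMfree ?row_free_unit // -[RHS](frame_rank A).
by rewrite eqmxMfull // row_full_unit.
Qed.

Definition frame_move (D : 'M[C]_n) (T : 'M[C]_d) (Du : D \in unitmx)
    (Tu : T \in unitmx) (A : frame) : frame :=
  mk_frame (frame_move_rank A Du Tu).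

Lemma frame_mx_continuous : continuous frame_mx.
Proof. exact: continuous_set_val. Qed.

Lemma frame_move_continuous D T (Du : D \in unitmx) (Tu : T \in unitmx) :
  continuous (frame_move Du Tu).
Proof.
apply: continuous_set_type.
apply: (continuous_compT (g := fun A : 'M[C]_(n, d) => D *m A *m T)).
  exact: frame_mx_continuous.
apply: continuous_mx_coord => i j.
under [X in continuous X]funext do rewrite mxE.
apply: continuous_big => [|k _]; first exact: add_continuous.
under [X in continuous X]funext do rewrite mxE mulr_suml.
apply: continuous_big => [|l _]; first exact: add_continuous.
apply: continuous_mulT; last exact: cst_continuous.
by apply: continuous_mulT; [exact: cst_continuous | exact: continuous_mx_entry].
Qed.

Lemma weight_mx_unit (t : C) : t != 0 -> weight_mx t \in unitmx.
Proof.
move=> t0; rewrite unitmxE det_diag unitfE; apply/prodf_neq0 => i _.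
by rewrite mxE expf_neq0.
Qed.

Lemma wgr_class_open (U : set frame) : open U -> open (wgr_class @` U).
Proof.
move=> oU; rewrite /open /= /quotient_open.
pose G := {g : frame -> frame | continuous g /\
  forall A, wgr_class (g A) = wgr_class A}.
rewrite (_ : _ @^-1` _ = \bigcup_(g : G) (sval g @^-1` U)).
  apply: bigcup_open => -[g [gc gE]] _ /=.
  by move/continuousP: gc; apply.
apply/seteqP; split=> [A [B UB AB]|A [[g [gc gE]] _ UgA]]; last first.
  by exists (g A) => //; exact: gE.
have /wgr_class_eqP[t [T [t0 Tu tT BE]]] : wgr_class A = wgr_class B.
  exact: esym AB.
have gP : continuous (frame_move (weight_mx_unit t0) Tu) /\
    forall A', wgr_class (frame_move (weight_mx_unit t0) Tu A') = wgr_class A'.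
  split; first exact: frame_move_continuous.
  by move=> A'; apply/esym/wgr_class_eqP; exists t, T.
pose g : G := exist _ (frame_move (weight_mx_unit t0) Tu) gP.
exists g => //; rewrite /preimage /=.
by rewrite (_ : frame_move _ _ A = B) //; apply: frame_eq.
Qed.

Definition torus_mx (t : torus R n) : 'M[C]_n := diag_mx (\row_i tcoord t i).

Lemma torus_mx_unit t : torus_mx t \in unitmx.
Proof.
rewrite unitmxE det_diag unitfE; apply/prodf_neq0 => i _.
by rewrite mxE tcoord_neq0.
Qed.

Lemma torus_mx_rank t (A : frame) : \rank (torus_mx t *m frame_mx A) = d.
Proof.
by rewrite eqmxMfull ?row_full_unit ?torus_mx_unit // frame_rank.
Qed.

Definition frame_act t (A : frame) : frame := mk_frame (torus_mx_rank t A).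

Definition wgr_act t (q : wgr) : wgr := wgr_class (frame_act t (repr q)).

Lemma diag_mxC (u v : 'rV[C]_n) : diag_mx u *m diag_mx v = diag_mx v *m diag_mx u.
Proof. by rewrite !mulmx_diag; congr diag_mx; apply/rowP=> i; rewrite !mxE mulrC. Qed.

Lemma wgr_actE t A : wgr_act t (wgr_class A) = wgr_class (frame_act t A).
Proof.
apply/wgr_class_eqP.
have /wgr_class_eqP[s [T [s0 Tu sT AE]]] := wgr_class_repr (wgr_class A).
exists s, T; split=> //.
by rewrite -[LHS]/(torus_mx t *m frame_mx A) AE !mulmxA diag_mxC.
Qed.

Lemma wgr_act1 q : wgr_act (torus1 R n) q = q.
Proof.
rewrite -[q]wgr_class_repr wgr_actE; congr wgr_class; apply: frame_eq.
rewrite -[LHS]/(torus_mx _ *m frame_mx _) (_ : torus_mx _ = 1%:M) ?mul1mx //.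
by rewrite -diag_const_mx; congr diag_mx; apply/rowP => i; rewrite !mxE.
Qed.

Lemma wgr_actM s t q : wgr_act (torusM s t) q = wgr_act s (wgr_act t q).
Proof.
rewrite -[q]wgr_class_repr !wgr_actE; congr wgr_class; apply: frame_eq.
rewrite -[LHS]/(torus_mx _ *m frame_mx _).
rewrite -[RHS]/(torus_mx s *m (torus_mx t *m frame_mx _)) mulmxA mulmx_diag.
by congr (diag_mx _ *m _); apply/rowP => i; rewrite !mxE.
Qed.

Lemma tcoord_continuous i : continuous (fun t : torus R n => tcoord t i).
Proof.
apply: (@continuous_compT _ _ _ set_val (fun x : {ptws 'I_n -> C} => x i)).
  exact: continuous_set_val.
exact: (@proj_continuous _ (fun=> C) i).
Qed.

Lemma frame_act_continuous :
  continuous (fun p : torus R n * frame => frame_act p.1 p.2).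
Proof.
apply: continuous_set_type; apply: continuous_mx_coord => i j.
rewrite (_ : (fun _ => _) = fun p : torus R n * frame =>
    tcoord p.1 i * frame_mx p.2 i j); last first.
  apply/funext => p; rewrite -[LHS]/((torus_mx p.1 *m frame_mx p.2) i j).
  by rewrite /torus_mx mul_diag_mx !mxE.
have tc : continuous (fun p : torus R n * frame => tcoord p.1 i).
  apply: (@continuous_compT _ _ _ fst (fun t : torus R n => tcoord t i)).
    by move=> p; exact: cvg_fst.
  exact: tcoord_continuous.
have Ac : continuous (fun p : torus R n * frame => frame_mx p.2 i j).
  apply: (@continuous_compT _ _ _ snd (fun A : frame => frame_mx A i j)).
    by move=> p; exact: cvg_snd.
  apply: (@continuous_compT _ _ _ frame_mx (fun A => A i j)).
    exact: frame_mx_continuous.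
  exact: continuous_mx_entry.
exact: continuous_mulT.
Qed.

Lemma wgr_act_continuous :
  continuous (fun p : torus R n * wgr => wgr_act p.1 p.2).
Proof.
have fc : continuous (fun p : torus R n * frame => wgr_class (frame_act p.1 p.2)).
  apply: continuous_compT; first exact: frame_act_continuous.
  exact: wgr_class_continuous.
move=> [t q] U; rewrite /= -[q in wgr_act t q]wgr_class_repr wgr_actE => Uq.
have [[P Q] /= [Pt Qq] PQ] := fc (t, repr q) U Uq.
exists (P, wgr_class @` Q) => /=.
  split=> //; rewrite -[q in nbhs q]wgr_class_repr.
  move: Qq; rewrite nbhsE => -[Q' [oQ' Q'q] Q'Q].
  rewrite nbhsE; exists (wgr_class @` Q'); last exact: image_subset.
  by split; [exact: wgr_class_open | exists (repr q)].
move=> [s r] /= [Ps [A QA <-]]; rewrite wgr_actE.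
exact: (PQ (s, A)).
Qed.

(* WGr(d, n) *)
Definition WGr : tspace R n := TSpace wgr_act1 wgr_actM wgr_act_continuous.

End WeightedGrassmannian.

Section SchubertSymbols.
Variables (n d : nat).

(* Schubert symbols, with entries shifted to {0, ..., n-1}: the classical
   lambda_(j+1) is (tnth l j).+1. *)
Definition schubert := {l : d.-tuple 'I_n | sorted ltn (map val l)}.

Definition sch_entry (l : schubert) (j : 'I_d) : 'I_n := tnth (val l) j.

Lemma sch_entry_inj l : injective (sch_entry l).
Proof.
have /(sorted_uniq ltn_trans ltnn)/map_uniq/tuple_uniqP := valP l; exact.
Qed.

(* The truncated subtraction is exact, as sch_entry l j >= j. *)
Definition sch_length (l : schubert) : nat := (\sum_(j < d) (sch_entry l j - j))%N.

Definition sch_le (l m : schubert) : bool :=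
  [forall j, (sch_entry l j <= sch_entry m j)%N].

(* R(l): replace some k in l by some k' < k not in l, and reorder *)
Definition sch_R (l : schubert) : pred schubert := fun m =>
  [exists k, exists k', [&& k \in val l, k' \notin val l, (k' < k)%N &
    perm_eq (val m) (k' :: rem k (val l))]].

Definition sch_c (W : 'I_n -> nat) (a : nat) (l : schubert) : nat :=
  (a + \sum_(j < d) W (sch_entry l j))%N.

Definition sch_Y (l : schubert) : ypoly n := \sum_(j < d) yvar (sch_entry l j).

End SchubertSymbols.

Section SchubertClasses.
Variables (R : realType) (n d : nat) (W : 'I_n -> nat) (a : nat).
Local Notation C := (Cplx R).
Implicit Types l m : schubert n d.

Definition sch_mx l : 'M[C]_(n, d) := \matrix_(i, j) (i == sch_entry l j)%:R.

Lemma sch_mx_rank l : \rank (sch_mx l) = d.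
Proof.
rewrite -mxrank_tr; apply/eqP/row_freeP; exists (sch_mx l).
apply/matrixP => i j; rewrite !mxE (bigD1 (sch_entry l i)) //= big1 => [|k ki].
  by rewrite !mxE eqxx mul1r addr0 (inj_eq (@sch_entry_inj _ _ l)).
by rewrite !mxE (negPf ki) mul0r.
Qed.

Definition sch_point l : WGr R d W a := wgr_class W a (mk_frame (sch_mx_rank l)).

Lemma sch_point_fixed (a_gt0 : (0 < a)%N) l (t : torus R n) :
  tact t (sch_point l) = sch_point l.
Proof.
rewrite /= /sch_point wgr_actE; apply/esym/wgr_class_eqP.
pose c := sch_c W a l.
have c_gt0 : (0 < c)%N by rewrite ltn_addr.
pose s : C := c.-root (\prod_(j < d) tcoord t (sch_entry l j)).
have sc : s ^+ c = \prod_(j < d) tcoord t (sch_entry l j) by rewrite rootCK.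
have s0 : s != 0.
  have : s ^+ c != 0 by rewrite sc; apply/prodf_neq0 => j _; exact: tcoord_neq0.
  by apply: contraNneq => ->; rewrite expr0n eqn0Ngt c_gt0.
pose T : 'M[C]_d := diag_mx (\row_j (tcoord t (sch_entry l j) / s ^+ W (sch_entry l j))).
have detT : s ^+ a = \det T.
  rewrite det_diag; under eq_bigr do rewrite mxE.
  rewrite big_split /= prodfV -sc /c /sch_c exprD -prodrXr mulfK //.
  by apply/prodf_neq0 => j _; rewrite expf_neq0.
exists s, T; split=> //.
  by rewrite unitmxE -detT unitfE expf_neq0.
rewrite -[LHS]/(torus_mx t *m sch_mx l) -[frame_mx _]/(sch_mx l).
apply/matrixP => i j.
rewrite /torus_mx /T /weight_mx mul_diag_mx mul_mx_diag mul_diag_mx !mxE.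
by case: eqP => [->|_]; rewrite ?(mulr0, mul0r, mulr1) // mulrCA divff ?mulr1 ?expf_neq0.
Qed.

Variable phi : point_ident R n.

(* x|_l in Z[y_1, ..., y_n] *)
Definition sch_restrict (a_gt0 : (0 < a)%N) l (x : HT (WGr R d W a)) : ypoly n :=
  ht_restrict phi (sch_point_fixed a_gt0 l) x.

(* Under divisiveness c(l) divides c(m) for all m in R(l), so that the
   natural-number quotient below is the exact one. *)
Definition is_schubert_class (a_gt0 : (0 < a)%N) l (x : HT (WGr R d W a)) : Prop :=
  [/\ forall m, sch_restrict a_gt0 m x != 0 -> sch_le l m,
      sch_restrict a_gt0 l x =
        \prod_(m | sch_R l m)
          (sch_Y m - sch_Y l *+ (sch_c W a m %/ sch_c W a l)) &
      forall m, yhomog (sch_length l)%:Z (sch_restrict a_gt0 m x)].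

End SchubertClasses.

Definition order_preserving_enum (n d : nat) (lam : 'I_'C(n, d) -> schubert n d) : Prop :=
  bijective lam /\ forall i j, sch_le (lam i) (lam j) -> (i <= j)%N.

Definition divisive (n d : nat) (W : 'I_n -> nat) (a : nat)
    (lam : 'I_'C(n, d) -> schubert n d) : Prop :=
  forall i j : 'I_'C(n, d), val j = (val i).+1 ->
    (sch_c W a (lam j) %| sch_c W a (lam i))%N.

(* Main.v *)
(* Restriction to a fixed point is a ring morphism and is linear over Z[y], so
   w S_i * w S_j = sum_k wc_ij^k w S_k becomes one polynomial identity for each
   fixed point.  The matrix of restrictions (w S_k)|_m is triangular for the
   order of the symbols and has nonzero diagonal entries; in the integral domain
   Z[y] the system can be solved for wc_ij^k by induction on k, and degree and
   support are read off from this recursion. *)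
From HB Require Import structures.
Require Import Defs.
From mathcomp Require Import all_boot all_order generic_quotient all_algebra.
From mathcomp Require Import all_classical reals topology normedtype.
From mathcomp Require Import complex.
From mathcomp Require Import -(notations) mpoly.

Set Implicit Arguments.
Unset Strict Implicit.
Unset Printing Implicit Defensive.

Import Order.TTheory GRing.Theory Num.Theory.
Local Open Scope ring_scope.

(** * Homogeneous components in Z[y] and division *)

HB.instance Definition _ (n : nat) := GRing.IntegralDomain.on (ypoly n).

(** Multiplication by [q] shifts the grading by [e], so among the homogeneous components of [p] only
    the [k]-th contributes. *)
Lemma pihomogMr (n : nat) (R : nzRingType) (mf : measure n) (k e : nat)
    (p q : mpoly n R) :
  q \is ishomog1 e mf -> pihomog mf (k + e) (p * q) = pihomog mf k p * q.
Proof.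
move=> qe; have kl : (k < mmeasure mf p + k.+1)%N by rewrite addnS ltnS leq_addl.
have pE := pihomog_partitionE (leq_addr k.+1 (mmeasure mf p)).
have piM i : pihomog mf i p * q \is ishomog1 (i + e) mf.
  exact: dhomogM (pihomogP _ _ _) qe.
rewrite [in LHS]pE mulr_suml raddf_sum /= (bigD1 (Ordinal kl)) //=.
rewrite (pihomog_dE (piM k)) big1 ?addr0 // => i ik.
apply: pihomog_ne0 (piM i).
by rewrite eqn_add2r; apply: contraNneq ik => E; apply/eqP/val_inj.
Qed.

Section YHomog.
Variable n : nat.
Implicit Types (p q : ypoly n) (d e : int).

Lemma yhomog0 d : yhomog d (0 : ypoly n).
Proof. by case: d => // k; exact: dhomog0. Qed.

Lemma yhomogB d p q : yhomog d p -> yhomog d q -> yhomog d (p - q).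
Proof.
case: d => k /= pd qd; last by rewrite pd qd subr0.
by apply: dhomogD; rewrite ?dhomogN.
Qed.

Lemma yhomog_sum d (I : finType) (P : pred I) (F : I -> ypoly n) :
  (forall i, P i -> yhomog d (F i)) -> yhomog d (\sum_(i | P i) F i).
Proof.
move=> Fd; apply: (big_ind (yhomog d)) => [|p q pd qd|//]; first exact: yhomog0.
case: d pd qd {Fd} => k /= pd qd; first exact: dhomogD.
by rewrite pd qd addr0.
Qed.

Lemma yhomogM d e p q : yhomog d p -> yhomog e q -> yhomog (d + e) (p * q).
Proof.
case: d => k pd; last by rewrite pd mul0r => _; exact: yhomog0.
case: e => l qe; last by rewrite qe mulr0; exact: yhomog0.
exact: dhomogM.
Qed.

(** A component of [p] of degree [k], times [q], is the component of [p * q] of degree [k + e]; it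
    vanishes unless [k + e = D], and [q] cancels in the domain Z[y]. *)
Lemma yhomog_divr (D e : nat) p q :
  q != 0 -> yhomog e%:Z q -> yhomog D%:Z (p * q) -> yhomog (D%:Z - e%:Z) p.
Proof.
move=> q0 qe pqD; have p0 k : (k + e)%N != D -> pihomog mdeg k p = 0.
  move=> kD; apply: (mulIf q0); rewrite mul0r -(pihomogMr _ _ qe).
  by apply: pihomog_ne0 pqD; rewrite eq_sym.
have pE := pihomog_partitionE (leqnn (mmeasure mdeg p)).
have [eD|De] := leqP e D.
  rewrite subzn //= pE rpred_sum // => k _.
  have [kD|/p0->] := eqVneq (k + e)%N D; last exact: dhomog0.
  by rewrite -kD addnK pihomogP.
(* Here [D < e]: no [k] satisfies [k + e = D], so every component of [p] is zero. *)
rewrite (_ : p = 0); first exact: yhomog0.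
rewrite pE big1 // => k _; apply: p0; rewrite gtn_eqF //.
exact: leq_trans De (leq_addl _ _).
Qed.

End YHomog.

(** * Triangular linear systems over Z[y] *)

Section TriangularSystem.
Variables (n N : nat) (le : rel 'I_N) (deg : 'I_N -> nat).
(** In the application [r i m] is the [i]-th Schubert class at the [m]-th fixed point, [c] the
    structure constants of one fixed pair, and [f] the restrictions of the product of that pair. *)
Variable r : 'I_N -> 'I_N -> ypoly n.
Hypothesis le_trans : transitive le.
Hypothesis le_ord : forall i j, le i j -> (i <= j)%N.
Hypothesis r_supp : forall i m, r i m != 0 -> le i m.
Hypothesis r_diag : forall i, r i i != 0.
Hypothesis r_homog : forall i m, yhomog (deg i)%:Z (r i m).
Variables (c : 'I_N -> ypoly n) (f : 'I_N -> ypoly n).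
Hypothesis c_def : forall m, f m = \sum_k c k * r k m.

(** The terms with [m > k] drop out of the [k]-th equation, since [r m k != 0] would force
    [m <= k]. *)
Lemma triangular_rec k :
  c k * r k k = f k - \sum_(m : 'I_N | (m < k)%N) c m * r m k.
Proof.
rewrite c_def (bigID (fun m : 'I_N => (m < k)%N)) /= addrAC subrr add0r.
rewrite (bigD1 k) ?ltnn //= big1 ?addr0 // => m /andP[km mk].
have [->|/r_supp/le_ord mk'] := eqVneq (r m k) 0; first by rewrite mulr0.
by case/eqP: mk; apply/val_inj/anti_leq; rewrite mk' leqNgt km.
Qed.

Lemma triangular_homog D : (forall m, yhomog D%:Z (f m)) ->
  forall k, yhomog (D%:Z - (deg k)%:Z) (c k).
Proof.
move=> fD k; have [b] := ubnP (k : nat); elim: b k => // b IH k kb.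
apply: (yhomog_divr (r_diag k) (r_homog k k)); rewrite triangular_rec.
apply: yhomogB => //; apply: yhomog_sum => m mk.
(* [D] is split as [(D - deg m) + deg m], the degrees of [c m] (by induction) and of [r m k]. *)
rewrite -[D%:Z](subrK (deg m)%:Z); apply: yhomogM (r_homog m k).
by apply: IH; exact: leq_trans mk _.
Qed.

(** If [le i k] fails, then [f k = 0], and a nonzero earlier term would give [le i m] by induction
    and [le m k] by support, hence [le i k]. So [c k * r k k = 0], which is impossible in a domain
    when [c k] is nonzero. *)
Lemma triangular_supp i : (forall m, f m != 0 -> le i m) ->
  forall k, c k != 0 -> le i k.
Proof.
move=> f_supp k; have [b] := ubnP (k : nat); elim: b k => // b IH k kb ck.
apply/negPn/negP => ik; case/negP: (mulf_neq0 ck (r_diag k)).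
have fk : f k = 0 by apply: contraNeq ik; exact: f_supp.
rewrite triangular_rec fk sub0r oppr_eq0 big1 // => m mk.
have [->|/r_supp mk'] := eqVneq (r m k) 0; first by rewrite mulr0.
have [->|cm] := eqVneq (c m) 0; first by rewrite mul0r.
by case/negP: ik; apply: le_trans mk'; apply: IH => //; exact: leq_trans mk _.
Qed.

(** For [m < i] the support property gives [c m = 0], so the recursion at [i] keeps one term. *)
Lemma triangular_diag i : (forall m, f m != 0 -> le i m) -> c i * r i i = f i.
Proof.
move=> /triangular_supp c_supp; rewrite triangular_rec big1 ?subr0 // => m mi.
have [->|/c_supp/le_ord] := eqVneq (c m) 0; first by rewrite mul0r.
by rewrite leqNgt mi.
Qed.

End TriangularSystem.

(** * Functoriality, and restriction to a fixed point as a Z[y]-linear ring map *)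

Section Pullback.
Variable R : realType.

(** Functoriality already holds on cochains. Asking only for pointwise agreement with [h] leaves the
    continuity structure on the composite free. *)
Lemma coh_map_comp (X Y Z : topologicalType) (f : continuousType X Y)
    (g : continuousType Y Z) (h : continuousType X Z) (u : cohomology R Z) :
  g \o f =1 h -> coh_map f (coh_map g u) = coh_map h u.
Proof.
move=> gf; rewrite -[u]coh_class_repr !coh_mapE; congr coh_class.
apply: val_inj; apply/funext => s.
rewrite -[LHS]/(cocycle_val (repr u) (sing_map g (sing_map f s))).
rewrite -[RHS]/(cocycle_val (repr u) (sing_map h s)).
by congr (cocycle_val _ _); apply: sing_eq => t; exact: gf.
Qed.

Lemma coh_map_id (X : topologicalType) (f : continuousType X X)
    (u : cohomology R X) : f =1 id -> coh_map f u = u.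
Proof.
move=> f_id; rewrite -[u]coh_class_repr coh_mapE; congr coh_class.
apply: val_inj; apply/funext => -[p s].
rewrite -[LHS]/(cocycle_val (repr u) (sing_map f (existT _ p s))).
by congr (cocycle_val _ _); apply: sing_eq => t; exact: f_id.
Qed.

Variables (n : nat) (X : tspace R n) (x : X) (xfix : forall t, tact t x = x).

(** The composite point -> X -> point is the identity, also on homotopy quotients; this makes
    restriction linear over Z[y]. *)
Lemma HT_map_fixed_pointK :
  cancel (HT_map (to_tpoint X)) (HT_map (fixed_point xfix)).
Proof.
move=> u; pose h := borel_map (to_tpoint X) \o borel_map (fixed_point xfix).
rewrite /HT_map (coh_map_comp (h := h)) // coh_map_id // => q.
rewrite -[q](reprK q : borel_class (repr q) = q) /h /= !borel_mapE.
by case: (repr q) => e [].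
Qed.

Variable phi : point_ident R n.

(** [pt_poly] is given only as an inverse function, so its additivity is checked after applying the
    injective ring morphism [phi]. *)
Lemma ht_restrict_sum (I : finType) (F : I -> HT X) :
  ht_restrict phi xfix (\sum_i F i) = \sum_i ht_restrict phi xfix (F i).
Proof.
apply: (can_inj (pt_classK phi)); rewrite pt_polyK !rmorph_sum.
by apply: eq_bigr => i _; rewrite pt_polyK.
Qed.

Lemma ht_restrictM (u v : HT X) :
  ht_restrict phi xfix (u * v) = ht_restrict phi xfix u * ht_restrict phi xfix v.
Proof. by apply: (can_inj (pt_classK phi)); rewrite rmorphM !pt_polyK rmorphM. Qed.

Lemma ht_restrict_scale (p : ypoly n) (u : HT X) :
  ht_restrict phi xfix (ht_scale phi p u) = p * ht_restrict phi xfix u.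
Proof. by rewrite ht_restrictM /ht_restrict HT_map_fixed_pointK pt_classK. Qed.

End Pullback.

(** * Schubert symbols and their weights *)

Section Schubert.
Variables n d : nat.
Implicit Types l m : schubert n d.

Lemma sch_le_trans : transitive (@sch_le n d).
Proof.
move=> m l k /forallP lm /forallP mk; apply/forallP => j.
exact: leq_trans (lm j) (mk j).
Qed.

Lemma mcoeff_sch_Y l (i : 'I_n) :
  mcoeff (mnm1 i) (sch_Y l) = (i \in val l)%:R.
Proof.
rewrite /sch_Y raddf_sum /=; under eq_bigr do rewrite /yvar mcoeffX eq_mnm1.
have [/tnthP[j ->]|il] := boolP (i \in val l); last first.
  by apply: big1 => j _; case: eqP il => // <-; rewrite mem_tnth.
rewrite (bigD1 j) //= eqxx big1 ?addr0 // => k kj.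
by rewrite (inj_eq (@sch_entry_inj _ _ l)) (negPf kj).
Qed.

(** The entry [i'] of [m] that replaces an entry of [l] is not in [l]: its variable has coefficient
    1 in [sch_Y m] and 0 in every multiple of [sch_Y l]. *)
Lemma sch_R_weight_neq0 l m (k : nat) : sch_R l m -> sch_Y m - sch_Y l *+ k != 0.
Proof.
case/existsP => i /existsP[i' /and4P[_ i'l _ lm]].
apply/eqP => /(congr1 (mcoeff (mnm1 i'))).
rewrite mcoeffB mcoeffMn !mcoeff_sch_Y (perm_mem lm) inE eqxx (negPf i'l).
by rewrite mul0rn subr0 mcoeff0.
Qed.

End Schubert.

Theorem lemma5p5 (R : realType) (n d : nat) (d_gt0 : (1 <= d)%N) (d_lt_n : (d < n)%N)
    (W : 'I_n -> nat) (a : nat) (a_gt0 : (1 <= a)%N)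
    (lam : 'I_'C(n, d) -> schubert n d)
    (lam_enum : order_preserving_enum lam)
    (lam_divisive : divisive W a lam)
    (phi : point_ident R n)
    (wS : 'I_'C(n, d) -> HT (WGr R d W a))
    (wS_class : forall i, is_schubert_class phi a_gt0 (lam i) (wS i))
    (wc : 'I_'C(n, d) -> 'I_'C(n, d) -> 'I_'C(n, d) -> ypoly n)
    (wc_def : forall i j, wS i * wS j = \sum_k ht_scale phi (wc i j k) (wS k)) :
  [/\ forall i j k,
        yhomog ((sch_length (lam i))%:Z + (sch_length (lam j))%:Z
                - (sch_length (lam k))%:Z) (wc i j k),
      forall i j k,
        ~ [/\ (sch_length (lam k) <= sch_length (lam i) + sch_length (lam j))%N,
              sch_le (lam i) (lam k) & sch_le (lam j) (lam k)] ->
        wc i j k = 0 &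
      forall i j, wc i j i = sch_restrict phi a_gt0 (lam i) (wS j)].
Proof.
have [_ lam_ord] := lam_enum.
pose le i j := sch_le (lam i) (lam j).
pose r i m := sch_restrict phi a_gt0 (lam m) (wS i).
have le_trans : transitive le by move=> j i k; exact: sch_le_trans.
have r_supp i m : r i m != 0 -> le i m by have [H _ _] := wS_class i; exact: H.
have r_diag i : r i i != 0.
  have [_ H _] := wS_class i; rewrite /r H; apply/prodf_neq0 => m.
  exact: sch_R_weight_neq0.
have r_homog i m : yhomog (sch_length (lam i))%:Z (r i m).
  by have [_ _ H] := wS_class i; exact: H.
(* Restricting the defining relation to the [m]-th fixed point gives the triangular system, with
   right-hand sides [r i m * r j m]. *)
have wc_restrict i j m : r i m * r j m = \sum_k wc i j k * r k m.
  rewrite /r /sch_restrict -ht_restrictM wc_def ht_restrict_sum.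
  by apply: eq_bigr => k _; rewrite ht_restrict_scale.
have supp_l i j m : r i m * r j m != 0 -> le i m.
  by rewrite mulf_eq0 negb_or => /andP[/r_supp].
have supp_r i j m : r i m * r j m != 0 -> le j m.
  by rewrite mulf_eq0 negb_or => /andP[_ /r_supp].
have degree i j k : yhomog ((sch_length (lam i))%:Z + (sch_length (lam j))%:Z
    - (sch_length (lam k))%:Z) (wc i j k).
  rewrite -PoszD.
  apply: (triangular_homog lam_ord r_supp r_diag r_homog
    (wc_restrict i j)) => m.
  by rewrite PoszD; exact: yhomogM.
split=> [//|i j k notin|i j].
- apply/eqP; apply: contra_notT notin => wc0; split.
  (* If [lam k] is too long, the degree is the opposite of a positive integer, where [yhomog] means
     being zero. *)
  + rewrite leqNgt; apply: contra_neqN wc0 => lt_len; move: (degree i j k).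
    rewrite -PoszD -opprB subzn ?(ltnW lt_len) //.
    by move: lt_len; rewrite -subn_gt0; case: (_ - _)%N.
  + exact: (triangular_supp le_trans lam_ord r_supp r_diag
      (wc_restrict i j) (supp_l i j)).
  + exact: (triangular_supp le_trans lam_ord r_supp r_diag
      (wc_restrict i j) (supp_r i j)).
(* At the fixed point [i] the system reduces to [wc i j i * r i i = r i i * r j i], and the nonzero
   [r i i] cancels. *)
- apply: (mulIf (r_diag i)).
  rewrite (triangular_diag le_trans lam_ord r_supp r_diag
    (wc_restrict i j) (supp_l i j)).
  exact: mulrC.
Qed.
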